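(* Let $\mathbb{Y}$ be a subspace of $\ell_1^n$ and let $\mathcal{A}=\{\widetilde{a_1},\ldots,\widetilde{a_m}\}$ be a basis of $\mathbb{Y}$ with $\mathcal{Z}_{\mathcal{A}}=\emptyset$. Suppose that $\mathcal{N}$ is a minimal norming set of $\mathbb{Y}$ and $\dim(\mathrm{span}\,\mathcal{N})=q$. Then $\mathbb{Y}$ is a coproximinal subspace of $\ell_1^n$ if and only if $q=m$.
   Context: $\ell_1^n$ and $\ell_\infty^n$ denote $\mathbb{R}^n$ with the norms $\sum_i|x_i|$ and $\max_i|x_i|$ respectively. For a linearly independent set $\mathcal{A}=\{\widetilde{a_1},\ldots,\widetilde{a_m}\}$ in $\ell_1^n$ with $\widetilde{a_k}=(a^k_1,\ldots,a^k_n)$, the zero set is $\mathcal{Z}_{\mathcal{A}}=\{i\in\{1,\ldots,n\}:(a_i^1,\ldots,a_i^m)=(0,\ldots,0)\}$. $\psi:\ell_1^n\to(\ell_\infty^n)^*$ is the canonical isometric isomorphism, $\psi(a_1,\ldots,a_n)(x_1,\ldots,x_n)=\sum_{i=1}^n a_ix_i$. For $g\in(\ell_\infty^n)^*$, $M_g=\{x\in\ell_\infty^n:\|x\|=1,\ |g(x)|=\|g\|\}$. $\mathrm{Ext}(B_{\ell_\infty^n})$ is the set of extreme points of the closed unit ball of $\ell_\infty^n$. A set $S$ is symmetric if $x\in S$ implies $-x\in S$. A symmetric set $\mathcal{N}$ is a norming set of a subspace $\mathbb{Y}\subset\ell_1^n$ if $(M_g\cap\mathrm{Ext}(B_{\ell_\infty^n}))\cap\mathcal{N}\ne\emptyset$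 for each $g\in\psi(\mathbb{Y})$. A norming set $\mathcal{N}$ of $\mathbb{Y}$ is a minimal norming set of $\mathbb{Y}$ if, for every norming set $\mathcal{M}$ of $\mathbb{Y}$, $\mathcal{M}\subset\mathcal{N}$ implies $\mathcal{M}=\mathcal{N}$. An element $y_0\in\mathbb{Y}$ is a best coapproximation to $x$ out of $\mathbb{Y}$ if $\|y_0-y\|\le\|x-y\|$ for all $y\in\mathbb{Y}$. A subspace $\mathbb{Y}$ of a Banach space $\mathbb{X}$ is coproximinal if every $x\in\mathbb{X}$ has a best coapproximation out of $\mathbb{Y}$. *)

(* Defs.v *)
From HB Require Import structures.
From mathcomp Require Import all_boot all_order all_algebra.
From mathcomp Require Import all_classical all_reals all_analysis.
Set Implicit Arguments.
Unset Strict Implicit.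
Unset Printing Implicit Defensive.
Import Order.TTheory GRing.Theory Num.Theory.
Import numFieldNormedType.Exports.
Local Open Scope classical_set_scope.
Local Open Scope ring_scope.

(* An alias, because the library norm on 'rV[R]_n is the sup norm.  Hence
   l1 R n below is $\ell_1^n$ and 'rV[R]_n itself is $\ell_\infty^n$. *)
Definition l1 (R : realType) (n : nat) : Type := 'rV[R]_n.

HB.instance Definition _ (R : realType) (n : nat) :=
  Vector.copy (l1 R n) 'rV[R]_n.

Definition l1_norm (R : realType) (n : nat) (x : l1 R n) : R :=
  \sum_(i < n) `|x 0 i|.

Section L1Norm.
Variables (R : realType) (n : nat).

Lemma l1_normD (x y : l1 R n) : l1_norm (x + y) <= l1_norm x + l1_norm y.
Proof.
rewrite /l1_norm -big_split /=; apply: ler_sum => i _.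
by rewrite mxE ler_normD.
Qed.

Lemma l1_normZ (a : R) (x : l1 R n) : l1_norm (a *: x) = `|a| * l1_norm x.
Proof.
by rewrite /l1_norm mulr_sumr; apply: eq_bigr => i _; rewrite mxE normrM.
Qed.

Lemma l1_norm0_eq0 (x : l1 R n) : l1_norm x = 0 -> x = 0.
Proof.
move=> /eqP; rewrite psumr_eq0 // => /allP x0.
apply/rowP => i; rewrite mxE; apply/eqP; rewrite -normr_eq0.
by apply: x0; rewrite mem_index_enum.
Qed.

End L1Norm.

HB.instance Definition _ (R : realType) (n : nat) :=
  Lmodule_isNormed.Build R (l1 R n) (@l1_normD R n) (@l1_normZ R n)
    (@l1_norm0_eq0 R n).

Lemma l1_normE (R : realType) (n : nat) (x : l1 R n) :
  `|x| = \sum_(i < n) `|x 0 i|.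
Proof. by []. Qed.

Lemma linfty_normE (R : realType) (n : nat) (x : 'rV[R]_n) :
  `|x| = \big[Num.max/0]_(i < n) `|x 0 i|.
Proof.
rewrite /Num.norm /= mx_normrE; apply/le_anti/andP; split.
  apply: bigmax_le => [|[i j] _]; first exact: bigmax_ge_id.
  by rewrite ord1; apply: (le_bigmax _ (fun j => `|x 0 j|)).
apply: bigmax_le => [|j _]; first exact: bigmax_ge_id.
exact: (le_bigmax _ (fun p : 'I_1 * 'I_n => `|x p.1 p.2|) (0, j)).
Qed.

Definition zero_set (R : realType) (n m : nat) (A : m.-tuple (l1 R n)) :
    {set 'I_n} :=
  [set i | [forall k, tnth A k 0 i == 0]]%SET.

(* Every linear functional on $\ell_\infty^n$ is continuous, so 'Hom is the
   whole dual space. *)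
Definition linfty_dual (R : realType) (n : nat) := 'Hom('rV[R]_n, R^o).

Definition dual_norm (R : realType) (n : nat) (g : linfty_dual R n) : R :=
  sup [set `|g x| | x in [set x : 'rV[R]_n | `|x| <= 1]].

Definition psi (R : realType) (n : nat) (a : l1 R n) : linfty_dual R n :=
  linfun (fun x : 'rV[R]_n => \sum_(i < n) a 0 i * x 0 i : R^o).

Lemma psiE (R : realType) (n : nat) (a : l1 R n) (x : 'rV[R]_n) :
  psi a x = \sum_(i < n) a 0 i * x 0 i.
Proof.
pose f (x : 'rV[R]_n) : R^o := \sum_(i < n) a 0 i * x 0 i.
have flin : linear f.
  move=> c u v; rewrite /f /GRing.scale /= mulr_sumr -big_split /=.
  by apply: eq_bigr => i _; rewrite !mxE mulrDr mulrCA.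
pose fL := GRing.isLinear.Build _ _ _ _ f flin.
pose F : {linear 'rV[R]_n -> R^o} := HB.pack f fL.
exact: (lfunE F x).
Qed.

Definition norm_attainment (R : realType) (n : nat) (g : linfty_dual R n) :
    set 'rV[R]_n :=
  [set x | `|x| = 1 /\ `|g x| = dual_norm g].

Definition extreme_points (R : realType) (V : lmodType R) (B : set V) :
    set V :=
  [set x | B x /\ forall (y z : V) (t : R), B y -> B z -> 0 < t < 1 ->
             x = t *: y + (1 - t) *: z -> y = x /\ z = x].

Definition symmetric_set (V : zmodType) (S : set V) : Prop :=
  forall x, S x -> S (- x).

Definition norming_set (R : realType) (n : nat) (Y : {vspace l1 R n})
    (N : set 'rV[R]_n) : Prop :=
  symmetric_set N /\
  forall g, [set psi y | y in [set` Y]] g ->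
    (norm_attainment g `&`
       extreme_points [set x : 'rV[R]_n | `|x| <= 1]) `&` N !=set0.

Definition minimal_norming_set (R : realType) (n : nat)
    (Y : {vspace l1 R n}) (N : set 'rV[R]_n) : Prop :=
  norming_set Y N /\ forall M, norming_set Y M -> M `<=` N -> M = N.

Definition best_coapproximation (R : realType) (V : normedModType R)
    (Y : set V) (x y0 : V) : Prop :=
  Y y0 /\ forall y, Y y -> `|y0 - y| <= `|x - y|.

Definition coproximinal (R : realType) (V : normedModType R) (Y : set V) :
    Prop :=
  forall x, exists y0, best_coapproximation Y x y0.

(* The library's <<X>>%VS takes a finite sequence; lspan takes an arbitrary,
   possibly infinite, set. *)
Lemma lspan_exists (K : fieldType) (V : vectType K) (S : set V) :
  exists W : {vspace V}, forall x, x \in W <->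
    exists2 s : seq V, (forall y, y \in s -> S y) & x \in << s >>%VS.
Proof.
pose P d := `[< exists2 s : seq V,
  forall y, y \in s -> S y & \dim << s >> = d >].
have exP : exists d, P d.
  by exists (\dim << [::] : seq V >>); apply/asboolP; exists [::].
have ubP d : P d -> (d <= \dim {:V})%N.
  by move=> /asboolP[s _ <-]; exact/dimvS/subvf.
case: (ex_maxnP exP ubP) => d /asboolP[s sS sd] dmax.
exists << s >>%VS => x; split=> [xs|[s' s'S xs']]; first by exists s.
have ss : (<< s >> <= << s ++ s' >>)%VS by rewrite span_cat addvSl.
have /eqP -> : (<< s >> == << s ++ s' >>)%VS.
  rewrite eqEdim ss sd; apply: dmax; apply/asboolP; exists (s ++ s') => // y.
  by rewrite mem_cat => /orP[/sS|/s'S].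
by rewrite span_cat; apply: (subvP (addvSr _ _)).
Qed.

Definition lspan (K : fieldType) (V : vectType K) (S : set V) : {vspace V} :=
  projT1 (cid (lspan_exists S)).

Lemma lspanP (K : fieldType) (V : vectType K) (S : set V) (x : V) :
  x \in lspan S <->
  exists2 s : seq V, (forall y, y \in s -> S y) & x \in << s >>%VS.
Proof. exact: (projT2 (cid (lspan_exists S)) x). Qed.

(* Main.v *)
(** A sign vector that agrees with [y] on its support norms [y].  As no
    coordinate vanishes on [Y], every [y] in [Y] can be perturbed inside [Y] to
    an element of full support without changing its nonzero signs, and an
    element of full support is normed only by [sgn y] and [- sgn y].  Hence the
    minimal norming set is N = {sgn y : y in Y of full support}.

    An element y0 of [Y] is a best coapproximation to [x] iff every [y] in [Y]
    satisfies ||y|| <= ||y + t (x - y0)|| for all [t]; differentiating at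
    [t = 0] for [y] of full support, this says that [x - y0] annihilates [N].
    Let [T] restrict a functional on the sup-normed space to [span N].  It is
    onto, of rank [q], and injective on [Y] because [N] norms [Y], so T(Y) has
    dimension [m].  Coproximinality means T(Y) = T(R^n), i.e., m = q. *)

Require Import Defs.
From HB Require Import structures.
From mathcomp Require Import all_boot all_order all_algebra.
From mathcomp Require Import all_classical all_reals all_analysis.
From mathcomp Require Import lra.
Set Implicit Arguments.
Unset Strict Implicit.
Unset Printing Implicit Defensive.
Import Order.TTheory GRing.Theory Num.Theory.
Import numFieldNormedType.Exports.
Local Open Scope classical_set_scope.
Local Open Scope ring_scope.

Lemma lspan_subvP (K : fieldType) (V : vectType K) (S : set V)
    (U : {vspace V}) :
  (forall x, S x -> x \in U) <-> (lspan S <= U)%VS.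
Proof.
split=> [SU|/subvP SU x Sx].
  apply/subvP => x /lspanP[s sS]; apply: subvP.
  by apply/span_subvP => y /sS /SU.
apply: SU; apply/lspanP; exists [:: x]; last by rewrite memv_span ?mem_head.
by move=> y; rewrite inE => /eqP ->.
Qed.

Lemma sgr_addl (R : realDomainType) (a b : R) :
  `|b| < `|a| -> Num.sg (a + b) = Num.sg a.
Proof.
rewrite ltr_norml; case: (ltgtP a 0) => [a0|a0|->].
- by rewrite ltr0_norm // => b_lt; rewrite !ltr0_sg //; lra.
- by rewrite gtr0_norm // => b_lt; rewrite !gtr0_sg //; lra.
- by rewrite normr0; lra.
Qed.

(** * Sign vectors, norm attainment and perturbations *)

Section SignVectors.
Variables (R : realType) (n : nat).
Implicit Types (x e : 'rV[R]_n) (y w z : l1 R n).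

Lemma linfty_norm_le1P x : `|x| <= 1 <-> forall i, `|x 0 i| <= 1.
Proof.
rewrite linfty_normE; split=> [/bigmax_leP[_ x1] i|x1]; first exact: x1.
by apply/bigmax_leP; split=> // i _; apply: x1.
Qed.

Lemma ler_norm_psi y x : `|x| <= 1 -> `|psi y x| <= `|y|.
Proof.
move=> /linfty_norm_le1P x1; rewrite psiE l1_normE.
apply: le_trans (ler_norm_sum _ _ _) _; apply: ler_sum => i _.
by rewrite normrM ler_piMr.
Qed.

Lemma psiDZl y z (t : R) x : psi (y + t *: z) x = psi y x + t * psi z x.
Proof.
rewrite !psiE mulr_sumr -big_split /=; apply: eq_bigr => i _.
by rewrite !mxE mulrDl mulrA.
Qed.

Definition sgn_vec y : 'rV[R]_n := \row_i Num.sg (y 0 i).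

Lemma sgn_vec_norm_le1 y : `|sgn_vec y| <= 1.
Proof.
apply/linfty_norm_le1P => i; rewrite mxE normr_sg.
by case: (_ != _).
Qed.

Lemma psi_sgn_vec y : psi y (sgn_vec y) = `|y|.
Proof.
by rewrite psiE l1_normE; apply: eq_bigr => i _; rewrite mxE normrEsg mulrC.
Qed.

(** The upper bound [ler_norm_psi] is attained at [sgn_vec y]. *)
Lemma dual_norm_psi y : dual_norm (psi y) = `|y|.
Proof.
rewrite /dual_norm; set S := (X in sup X).
have Sub : ubound S `|y| by move=> _ [x x1 <-]; apply: ler_norm_psi.
have Sy : S `|y|.
  exists (sgn_vec y); first exact: sgn_vec_norm_le1.
  by rewrite psi_sgn_vec normr_id.
apply/le_anti/andP; split; first by apply: ge_sup => //; exists `|y|.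
by apply: sup_upper_bound => //; split; exists `|y|.
Qed.

Definition full_support y := forall i, y 0 i != 0.

Lemma sgn_vecN y : sgn_vec (- y) = - sgn_vec y.
Proof. by apply/rowP => i; rewrite !mxE sgrN. Qed.

Lemma full_supportN y : full_support y -> full_support (- y).
Proof. by move=> yF i; rewrite mxE oppr_eq0. Qed.

(** The gaps between [|y 0 i|] and [y 0 i * x 0 i] are nonnegative with sum zero, so each vanishes,
    and the nonzero [y 0 i] cancels. *)
Lemma full_support_normed y x :
  full_support y -> `|x| <= 1 -> psi y x = `|y| -> x = sgn_vec y.
Proof.
move=> yF /linfty_norm_le1P x1; rewrite psiE l1_normE => yx.
have d_ge0 i : 0 <= `|y 0 i| - y 0 i * x 0 i.
  rewrite subr_ge0 (le_trans (ler_norm _)) // normrM ler_piMr //.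
have : \sum_i (`|y 0 i| - y 0 i * x 0 i) == 0 by rewrite sumrB yx subrr.
rewrite psumr_eq0 // => /allP d0; apply/rowP => i; rewrite mxE.
have := d0 i (mem_index_enum i); rewrite /= subr_eq0 normrEsg mulrC => /eqP.
by move/(mulfI (yF i)).
Qed.

Lemma full_support_norm_attainment y x :
  full_support y -> norm_attainment (psi y) x ->
  x = sgn_vec y \/ x = - sgn_vec y.
Proof.
move=> yF [x1]; rewrite dual_norm_psi => /eqP.
rewrite eqr_norml normr_ge0 andbT => /orP[] /eqP yx.
  by left; apply: full_support_normed; rewrite ?x1.
right; rewrite -[x]opprK; congr (- _).
by apply: full_support_normed; rewrite ?normrN ?x1 // linearN /= yx opprK.
Qed.

(** Each coordinate is an endpoint of the interval from -1 to 1, so it is no proper convex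
    combination of other points there. *)
Lemma extreme_sgn_vec y :
  full_support y -> extreme_points [set x : 'rV[R]_n | `|x| <= 1] (sgn_vec y).
Proof.
move=> yF; split=> [|u v t /linfty_norm_le1P u1 /linfty_norm_le1P v1 t01 E].
  exact: sgn_vec_norm_le1.
suff uv i : u 0 i = Num.sg (y 0 i) /\ v 0 i = Num.sg (y 0 i).
  by split; apply/rowP => i; rewrite mxE; case: (uv i).
have /rowP/(_ i) := E; rewrite !mxE.
have := u1 i; have := v1 i; rewrite !ler_norml.
have [yi|yi|/eqP] := ltgtP (y 0 i) 0; last by rewrite (negPf (yF i)).
  by rewrite ltr0_sg //; move: t01 => /andP[*]; split; nra.
by rewrite gtr0_sg //; move: t01 => /andP[*]; split; nra.
Qed.

Lemma small_scaling y z :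
  exists2 t : R, 0 < t & forall i, y 0 i != 0 -> t * `|z 0 i| < `|y 0 i|.
Proof.
(* The summand 1 avoids division by zero and makes the bound strict; the default 1 of the minimum
   below covers [y = 0]. *)
pose r i := `|y 0 i| / (1 + `|z 0 i|).
have z1 i : 0 < 1 + `|z 0 i| by rewrite ltr_pwDl.
exists (\big[Num.min/1]_(i | y 0 i != 0) r i).
  by apply: lt_bigmin => // i yi; rewrite divr_gt0 ?normr_gt0.
move=> i yi; apply: (@le_lt_trans _ _ (r i * `|z 0 i|)).
  by rewrite ler_wpM2r // bigmin_le_cond.
by rewrite /r mulrAC ltr_pdivrMr // ltr_pM2l ?normr_gt0 // ltrDr.
Qed.

(** Small multiples of [z] change no sign of [y], so one sign vector norms the whole segment;
    [psi z (sgn_vec y)] is the derivative of the norm along [z]. *)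
Lemma l1_norm_near y z :
  full_support y -> exists2 t : R, 0 < t &
    forall s, `|s| <= t -> `|y + s *: z| = `|y| + s * psi z (sgn_vec y).
Proof.
move=> yF; have [t t0 tz] := small_scaling y z; exists t => // s st.
suff yz : sgn_vec (y + s *: z) = sgn_vec y.
  by rewrite -[LHS]psi_sgn_vec yz psiDZl psi_sgn_vec.
apply/rowP => i; rewrite !mxE sgr_addl // normrM.
by apply: le_lt_trans (tz i (yF i)); rewrite ler_wpM2r.
Qed.

Lemma full_support_perturb (Y : {vspace l1 R n}) y :
  (forall i, exists2 a, a \in Y & a 0 i != 0) -> y \in Y ->
  exists w, [/\ w \in Y, full_support w &
    forall i, y 0 i != 0 -> Num.sg (w 0 i) = Num.sg (y 0 i)].
Proof.
move=> YZ yY.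
suff [w [wY wF wy]] : exists w, [/\ w \in Y,
    forall i, i \in enum 'I_n -> w 0 i != 0 &
    forall i, y 0 i != 0 -> Num.sg (w 0 i) = Num.sg (y 0 i)].
  by exists w; split=> // i; apply: wF; rewrite mem_enum.
(* Coordinates are made nonzero one at a time, each by adding a multiple of some [a] in [Y] too
   small to alter the nonzero signs of [w]. *)
elim: (enum 'I_n) => [|i s [w [wY ws wy]]]; first by exists y; split.
have [wi|wi] := eqVneq (w 0 i) 0; last first.
  by exists w; split=> // j; rewrite inE => /predU1P[->|/ws].
have [a aY ai] := YZ i; have [t t0 ta] := small_scaling w a.
have sgw j : w 0 j != 0 -> Num.sg ((w + t *: a) 0 j) = Num.sg (w 0 j).
  by move=> wj; rewrite !mxE sgr_addl // normrM (gtr0_norm t0) ta.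
exists (w + t *: a); split=> [|j|j yj]; first by rewrite memvD ?memvZ.
  rewrite inE => /predU1P[->|/ws wj].
    by rewrite !mxE wi add0r mulf_eq0 negb_or ai gt_eqF.
  by have := sgw j wj; rewrite -sgr_eq0 => ->; rewrite sgr_eq0.
by rewrite sgw ?wy // -sgr_eq0 wy // sgr_eq0.
Qed.

End SignVectors.

(** * The minimal norming set and best coapproximations *)

Section MinimalNormingSet.
Variables (R : realType) (n : nat) (Y : {vspace l1 R n}) (N : set 'rV[R]_n).
Hypothesis YZ : forall i, exists2 a, a \in Y & a 0 i != 0.
Hypothesis Nmin : minimal_norming_set Y N.

Lemma minimal_norming_setE :
  N = [set sgn_vec y | y in [set y | y \in Y /\ full_support y]].
Proof.
set G := [set _ | _ in _]; have [[Nsym Nnorm] Nmin'] := Nmin.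
(* A unit vector excludes [n = 0], where sign vectors have norm 0. *)
have x1P : exists x : 'rV[R]_n, `|x| = 1.
  have [|x [[[x1 _] _] _]] := Nnorm (psi 0); last by exists x.
  by exists 0 => //=; apply: mem0v.
(* By minimality, it is enough that [G] lies in [N] and norms [Y]. *)
apply/esym/Nmin'; last first.
  move=> _ [y [yY yF] <-].
  have [|x [[/(full_support_norm_attainment yF)]]] := Nnorm (psi y).
    by exists y.
  by move=> [->//|-> _ /Nsym]; rewrite opprK.
split=> [_ [y [yY yF] <-]|_ [y yY <-]].
  exists (- y); last by rewrite sgn_vecN.
  by split; [rewrite memvN|exact: full_supportN].
have [w [wY wF wy]] := full_support_perturb YZ yY.
exists (sgn_vec w); split; last by exists w.
split; last exact: extreme_sgn_vec.
split; last first.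
  rewrite dual_norm_psi psiE l1_normE -[RHS]ger0_norm ?sumr_ge0 //.
  congr `|_|; apply: eq_bigr => i _; rewrite mxE.
  have [->|yi] := eqVneq (y 0 i) 0; first by rewrite mul0r normr0.
  by rewrite wy // mulrC normrEsg.
apply/le_anti; rewrite sgn_vec_norm_le1 /=.
have [x x1] := x1P; rewrite -{1}x1 !linfty_normE.
apply/bigmax_leP; split=> [|i _]; first exact: bigmax_ge_id.
apply: le_trans (le_bigmax _ _ i); rewrite mxE normr_sg wF.
by have /linfty_norm_le1P : `|x| <= 1 by rewrite x1.
Qed.

Lemma norming_set_annihilator w :
  w \in Y -> (forall e, N e -> psi w e = 0) -> w = 0.
Proof.
move=> wY wN; have [[_ Nnorm] _] := Nmin.
have [|x [[[_ wx] _] /wN wx0]] := Nnorm (psi w); first by exists w.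
by apply/normr0_eq0; rewrite -dual_norm_psi -wx wx0 normr0.
Qed.

Lemma best_coapproximationP (x y0 : l1 R n) :
  best_coapproximation [set` Y] x y0 <->
  y0 \in Y /\ forall e, N e -> psi (x - y0) e = 0.
Proof.
split=> [[y0Y y0x]|[y0Y xN]]; split=> //.
  have y0x' (y : l1 R n) : y \in Y -> `|y0 - y| <= `|x - y| := y0x y.
  have le_norm w (s : R) : w \in Y -> s != 0 -> `|w| <= `|w + s *: (x - y0)|.
    move=> wY s0.
    (* For this element of [Y] the two differences are [s^-1 *: w] and [x - y0 + s^-1 *: w]; both
       norms are then scaled by [|s|]. *)
    have := y0x' (y0 - s^-1 *: w); rewrite memvB ?memvZ // => /(_ isT).
    rewrite !opprB !addrA (addrC y0) addrK (addrAC x).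
    rewrite -(ler_pM2l (_ : 0 < `|s|)) ?normr_gt0 // -!normrZ scalerDr.
    by rewrite scalerA divff // scale1r (addrC w).
  rewrite minimal_norming_setE => _ [w [wY wF] <-].
  have [t t0 wt] := l1_norm_near (x - y0) wF.
  (* The two signs of [t] bound the derivative from both sides by 0. *)
  have := le_norm w t wY; have := le_norm w (- t) wY.
  rewrite oppr_eq0 gt_eqF // !wt ?normrN ?(gtr0_norm t0) //.
  move=> /(_ isT) + /(_ isT); rewrite !lerDl mulNr oppr_ge0 => h1 h2.
  by apply/eqP; rewrite eq_le -(pmulr_rle0 _ t0) h1 -(pmulr_rge0 _ t0) h2.
(* Conversely, a vector [e] of [N] norming [y0 - w] takes the same value on [x - w], whose norm is
   therefore at least as large. *)
move=> w wY; have vY : y0 - w \in Y by rewrite memvB.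
have [[Nsym Nnorm] _] := Nmin.
have [|e [[[e1 ve] _] /xN xe]] := Nnorm (psi (y0 - w)).
  by exists (y0 - w).
have ex : psi (x - w) e = psi (y0 - w) e.
  have -> : x - w = (y0 - w) + 1 *: (x - y0).
    by rewrite scale1r (addrC (y0 - w)) addrA subrK.
  by rewrite psiDZl xe mulr0 addr0.
by rewrite -dual_norm_psi -ve -ex ler_norm_psi // e1.
Qed.

End MinimalNormingSet.

(** * Restriction to the span of [N] and the dimension count *)

Lemma coordinate_functionals_onto (R : realType) (n q : nat)
    (b : q.-tuple 'rV[R]_n) (u : 'rV[R]_q) :
  free b -> exists x : l1 R n, forall j, psi x (tnth b j) = u 0 j.
Proof.
move=> bfree; pose B : 'M[R]_(q, n) := \matrix_j tnth b j.
have Bfree : row_free B.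
  apply: inj_row_free => v vB0; apply/rowP => j; rewrite mxE.
  apply: (freeP bfree (fun k => v 0 k)).
  rewrite -[RHS]vB0 mulmx_sum_row; apply: eq_bigr => k _.
  by rewrite rowK (tnth_nth 0).
(* The rows of [B] are free, so [pinvmx B] is a right inverse; its transpose solves
   [x *m B^T = u]. *)
exists (u *m (pinvmx B)^T) => j.
have /rowP/(_ j) : u *m (pinvmx B)^T *m B^T = u.
  by rewrite -mulmxA -trmx_mul mulmxVp // trmx1 mulmx1.
rewrite psiE => <-; rewrite [RHS]mxE; apply: eq_bigr => i _.
by rewrite !mxE.
Qed.

Unset Implicit Arguments.
Set Strict Implicit.

Theorem theorem2p12 (R : realType) (n m q : nat) (Y : {vspace l1 R n})
    (A : m.-tuple (l1 R n)) (N : set 'rV[R]_n)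
    (hA : basis_of Y A) (hZ : zero_set A = finset.set0)
    (hN : minimal_norming_set Y N) (hq : \dim (lspan N) = q) :
  coproximinal [set` Y] <-> q = m.
Proof.
have YZ i : exists2 a, a \in Y & a 0 i != 0.
  have : i \notin zero_set A by rewrite hZ inE.
  rewrite inE negb_forall => /existsP[k ki]; exists (tnth A k) => //.
  by rewrite (basis_mem hA) // mem_tnth.
pose b := vbasis (lspan N).
(* The restriction of [psi x] to [lspan N], recorded by its values on a basis. *)
pose Tf (x : l1 R n) : 'rV[R]_(\dim (lspan N)) := \row_j psi x (tnth b j).
have Tlin : linear Tf.
  move=> t u v; rewrite (addrC (t *: u)); apply/rowP => j.
  rewrite !mxE [RHS]addrC; exact: psiDZl.
pose TL := GRing.isLinear.Build _ _ _ _ Tf Tlin.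
pose TF : {linear l1 R n -> 'rV[R]_(\dim (lspan N))} := HB.pack Tf TL.
pose T := linfun TF.
have TE x : T x = Tf x by rewrite lfunE.
have kerT x : T x = 0 <-> forall e, N e -> psi x e = 0.
  have -> : (forall e, N e -> psi x e = 0) <->
            (forall e, N e -> e \in lker (psi x)).
    by split=> xN e /xN; rewrite memv_ker => /eqP.
  have bspan := span_basis (vbasisP (lspan N)).
  rewrite lspan_subvP TE; split=> [/rowP x0|].
    rewrite -[X in (X <= _)%VS]bspan; apply/span_subvP => _ /tnthP[j ->].
    by rewrite memv_ker; have := x0 j; rewrite !mxE => ->.
  rewrite -[X in (X <= _)%VS]bspan => /span_subvP xN.
  apply/rowP => j; rewrite !mxE; apply/eqP.
  by rewrite -memv_ker xN // mem_tnth.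
have limgT : limg T = fullv.
  apply/vspaceP => u; rewrite memvf.
  have [x xu] := coordinate_functionals_onto u (basis_free (vbasisP (lspan N))).
  apply/memv_imgP; exists x; first exact: memvf.
  by rewrite TE; apply/rowP => j; rewrite mxE xu.
have dimTY : \dim (T @: Y) = m.
  rewrite limg_dim_eq ?(dim_basis hA) // ?(size_basis hA) //.
  apply/vspaceP => w; rewrite memv_cap memv_ker memv0.
  apply/andP/eqP => [[wY /eqP/kerT]|->]; last by rewrite mem0v linear0.
  exact: norming_set_annihilator hN _ wY.
(* An element [y0] of [Y] is a best coapproximation to [x] exactly when [T x = T y0]. *)
have coproxE : coproximinal [set` Y] <-> (limg T <= T @: Y)%VS.
  split=> [cop|/subvP sub x].
    apply/subvP => _ /memv_imgP[x _ ->].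
    have [y0 /(best_coapproximationP YZ hN)[y0Y /kerT]] := cop x.
    by rewrite linearB /= => /subr0_eq ->; rewrite memv_img.
  have /memv_imgP[y0 y0Y xy0] := sub _ (memv_img T (memvf x)).
  exists y0; apply/(best_coapproximationP YZ hN); split=> //.
  by apply/kerT; rewrite linearB /= xy0 subrr.
have dimTl : \dim (limg T) = q by rewrite limgT dimvf /dim /= mul1n hq.
rewrite coproxE; have TYs : (T @: Y <= limg T)%VS by rewrite limgS ?subvf.
split=> [sub|qm].
  by rewrite -dimTl -dimTY; apply/eqP; rewrite eqn_leq !dimvS.
suff /eqP -> : (T @: Y == limg T)%VS by exact: subvv.
by rewrite eqEdim TYs dimTl dimTY qm leqnn.
Qed.
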